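(* Let $a,b\in\mathbb{R}^n$ and let $Q\in\mathbb{R}^{n\times n}$ be positive semidefinite. The relaxation (OptPairs) of (QI) is at least as strong as the relaxation (OptRankOne) $$\begin{aligned}\min_{x,y,Y}\ & a'x+b'y+\langle Q,Y\rangle\\ \text{s.t. } & Y-yy'\succeq0,\\ & y_i^2\le Y_{ii}x_i,\qquad i=1,\dots,n,\\ & \begin{pmatrix}x_i+x_j&y_i&y_j\\ y_i&Y_{ii}&Y_{ij}\\ y_j&Y_{ij}&Y_{jj}\end{pmatrix}\succeq0\qquad \text{for all } i<j,\\ & y\ge0,\ 0\le x\le1,\end{aligned}$$ over $x,y\in\mathbb{R}^n$ and symmetric $Y\in\mathbb{R}^{n\times n}$, where (QI) and (OptPairs) are as defined in the context.
   Context: A prime denotes transpose, $\langle Q,Y\rangle=\sum_{i,j}Q_{ij}Y_{ij}$, and $A\succeq0$ means symmetric positive semidefinite. (QI): $\min\{a'x+b'y+y'Qy:(x,y)\in\mathcal I_n\}$, $\mathcal I_n=\{(x,y)\in\{0,1\}^n\times\mathbb{R}^n_+: y_i(1-x_i)=0,\ i=1,\dots,n\}$. (OptPairs): minimize $a'x+b'y+\langle Q,Y\rangle$ over $x,y\in\mathbb{R}^n$ and symmetric $Y\in\mathbb{R}^{n\times n}$ subject to $Y-yy'\succeq0$; $(x_i,x_j,y_i,y_j,Y_{ii},Y_{ij},Y_{jj})\in\mathcal W$ for all $i<j$; $0\le x\le1$; $y\ge0$. Here $\mathcal W$ is the set of points $(x_1,x_2,y_1,y_2,Y_{11},Y_{12},Y_{22})$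 for which there exists a symmetric $3\times3$ matrix $W\succeq 0$ with - $W_{12}=Y_{12}$; - $(Y_{11}-W_{11})(x_1-W_{33})\ge(y_1-W_{31})^2$, $W_{11}\le Y_{11}$, $W_{33}\le x_1$; - $(Y_{22}-W_{22})(x_2-W_{33})\ge(y_2-W_{32})^2$, $W_{22}\le Y_{22}$, $W_{33}\le x_2$; - $0\le W_{31}\le y_1$, $0\le W_{32}\le y_2$; - $W_{33}\ge x_1+x_2-1$. A relaxation A is at least as strong as a relaxation B if, for every instance $(a,b,Q)$, the optimal value (infimum) of A is at least that of B.
   Formalization: The formal theorem assumes n ≥ 2; for n = 1 (OptPairs) has no pair constraints and the claim fails (a=1, b=-2, Q=1: value -1 in OptPairs at x=0, y=Y=1, but at least 0 in OptRankOne). *)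

(* Defs.v *)
From mathcomp Require Import all_boot all_order all_algebra.
From mathcomp Require Import all_classical all_reals all_analysis.

Set Implicit Arguments.
Unset Strict Implicit.
Unset Printing Implicit Defensive.
Import Order.TTheory GRing.Theory Num.Theory.
Local Open Scope classical_set_scope.
Local Open Scope ring_scope.

Section Relaxations.
Variable R : realType.

Definition psdmx n (A : 'M[R]_n) : Prop :=
  A^T = A /\ forall v : 'cV[R]_n, 0 <= (v^T *m A *m v) 0 0.

Definition frob n (Q Y : 'M[R]_n) : R := \sum_(i < n) \sum_(j < n) Q i j * Y i j.

Definition mx3 (r : seq (seq R)) : 'M[R]_3 :=
  \matrix_(i < 3, j < 3) (nth [::] r i)`_j.

(* Indices are shifted by one: [W 0 1] is W_12, [W 2 2] is W_33, etc. *)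
Definition pair_hull (x1 x2 y1 y2 Y11 Y12 Y22 : R) : Prop :=
  exists W : 'M[R]_3,
    [/\ psdmx W, W 0 1 = Y12,
        [/\ (y1 - W 2 0) ^+ 2 <= (Y11 - W 0 0) * (x1 - W 2 2),
            W 0 0 <= Y11 & W 2 2 <= x1],
        [/\ (y2 - W 2 1) ^+ 2 <= (Y22 - W 1 1) * (x2 - W 2 2),
            W 1 1 <= Y22 & W 2 2 <= x2]
      & [/\ 0 <= W 2 0 <= y1, 0 <= W 2 1 <= y2 & x1 + x2 - 1 <= W 2 2]].

Definition lifted n : Type := ('cV[R]_n * 'cV[R]_n * 'M[R]_n)%type.

Definition opt_pairs n : set (lifted n) := [set p : lifted n | let: (x, y, Y) := p in
  [/\ Y^T = Y, psdmx (Y - y *m y^T),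
      forall i j : 'I_n, (i < j)%N ->
        pair_hull (x i 0) (x j 0) (y i 0) (y j 0) (Y i i) (Y i j) (Y j j),
      forall i, 0 <= x i 0 <= 1
    & forall i, 0 <= y i 0]].

Definition opt_rank_one n : set (lifted n) := [set p : lifted n | let: (x, y, Y) := p in
  [/\ Y^T = Y, psdmx (Y - y *m y^T),
      forall i, (y i 0) ^+ 2 <= Y i i * x i 0,
      forall i j : 'I_n, (i < j)%N ->
        psdmx (mx3 [:: [:: x i 0 + x j 0; y i 0; y j 0];
                       [:: y i 0;         Y i i; Y i j];
                       [:: y j 0;         Y i j; Y j j]])
    & (forall i, 0 <= y i 0) /\ (forall i, 0 <= x i 0 <= 1)]].

Definition objective n (a b : 'cV[R]_n) (Q : 'M[R]_n) (p : lifted n) : R :=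
  let: (x, y, Y) := p in (a^T *m x) 0 0 + (b^T *m y) 0 0 + frob Q Y.

Definition opt_value n (a b : 'cV[R]_n) (Q : 'M[R]_n) (F : set (lifted n)) :
  \bar R := ereal_inf [set (objective a b Q p)%:E | p in F].

End Relaxations.
Arguments opt_pairs : clear implicits.
Arguments opt_rank_one : clear implicits.

(* Main.v *)
Require Import Defs.
From mathcomp Require Import all_boot all_order all_algebra.
From mathcomp Require Import all_classical all_reals all_analysis.
From mathcomp Require Import ring lra.

(** Every point feasible for (OptPairs) is feasible for (OptRankOne), with the
    same objective value, so the infimum over the smaller feasible set is the
    larger one.

    Fix a pair i < j (written 1, 2) and a witness W for it.  The hyperbolic
    constraint on index k says that the symmetric 2 x 2 matrix
      A_k = (x_k - W33, y_k - W3k; y_k - W3k, Y_kk - W_kk)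
    is positive semidefinite.  Adding to A_k the principal submatrix
    (W33, W3k; W3k, W_kk) of W gives (x_k, y_k; y_k, Y_kk) >= 0, which is
    y_k ^ 2 <= Y_kk x_k.  Adding instead both A_1 and A_2, placed on the rows
    {0, 1} and {0, 2}, to W with its third row moved to the front gives the
    rank-one matrix of the pair except that its corner entry is
    x_1 + x_2 - W33; since W33 >= 0, the missing W33 in the corner can be added
    without losing positivity.

    All sums of matrices are carried out on quadratic forms: a 2 x 2 block
    enters as a binary form through its discriminant ([quad2_ge0],
    [discr_quad2_ge0]), a 3 x 3 matrix as an explicit ternary form
    ([mx3_formE]).  As n >= 2, every index lies in some pair, which gives the
    constraint y_i ^ 2 <= Y_ii x_i for all i. *)

Set Implicit Arguments.
Unset Strict Implicit.
Unset Printing Implicit Defensive.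
Import Order.TTheory GRing.Theory Num.Theory.
Local Open Scope classical_set_scope.
Local Open Scope ring_scope.

Lemma quad2_ge0 (R : realFieldType) (r t s : R) :
  0 <= r -> 0 <= s -> t ^+ 2 <= r * s ->
  forall p q : R, 0 <= r * p ^+ 2 + 2 * t * p * q + s * q ^+ 2.
Proof.
move=> r0 s0 trs p q; move: r0; rewrite le_eqVlt => /predU1P[r0|r_gt0].
  have t0 : t = 0.
    by apply/eqP; rewrite -sqrf_eq0 eq_le sqr_ge0 andbT (le_trans trs)// -r0 mul0r.
  by rewrite t0 -r0 mulr0 !mul0r !add0r mulr_ge0 ?sqr_ge0.
(* Completing the square after multiplication by the positive r. *)
rewrite -(pmulr_rge0 _ r_gt0).
have -> : r * (r * p ^+ 2 + 2 * t * p * q + s * q ^+ 2) =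
          (r * p + t * q) ^+ 2 + (r * s - t ^+ 2) * q ^+ 2 by ring.
by rewrite addr_ge0 ?sqr_ge0// mulr_ge0 ?sqr_ge0// subr_ge0.
Qed.

Lemma discr_quad2_ge0 (R : realFieldType) (r t s : R) :
  (forall p q : R, 0 <= r * p ^+ 2 + 2 * t * p * q + s * q ^+ 2) ->
  t ^+ 2 <= r * s.
Proof.
move=> form_ge0.
have r0 : 0 <= r by have := form_ge0 1 0; lra.
move: r0; rewrite le_eqVlt => /predU1P[r0|r_gt0].
  (* For r = 0 this point gives the value - t ^ 2, which forces t = 0. *)
  have := form_ge0 (- (s + 1) / 2) t; rewrite -r0.
  have -> : 0 * (- (s + 1) / 2) ^+ 2 + 2 * t * (- (s + 1) / 2) * t + s * t ^+ 2 =
            - t ^+ 2 by field.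
  by rewrite oppr_ge0 mul0r.
(* The minimiser of the form along q = r, where its value is r (r s - t ^ 2). *)
have := form_ge0 (- t) r.
have -> : r * (- t) ^+ 2 + 2 * t * - t * r + s * r ^+ 2 = r * (r * s - t ^+ 2).
  by ring.
by rewrite pmulr_rge0// subr_ge0.
Qed.

Lemma mx3_formE (R : realType) (A : 'M[R]_3) (v : 'cV[R]_3) : A^T = A ->
  (v^T *m A *m v) 0 0 =
  A 0 0 * v 0 0 ^+ 2 + A 1 1 * v 1 0 ^+ 2 + A 2 2 * v 2 0 ^+ 2
  + 2 * A 0 1 * v 0 0 * v 1 0 + 2 * A 2 0 * v 2 0 * v 0 0
  + 2 * A 2 1 * v 2 0 * v 1 0.
Proof.
move=> symA.
have symE i j : A i j = A j i by rewrite -[in LHS]symA mxE.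
have o1 : lift ord0 ord0 = 1 :> 'I_3 by apply/val_inj.
have o2 : lift ord0 (lift ord0 ord0) = 2 :> 'I_3 by apply/val_inj.
rewrite mxE !big_ord_recl big_ord0 !mxE !big_ord_recl !big_ord0 !mxE.
rewrite !o1 !o2 (symE 1 0) (symE 0 2) (symE 1 2) (symE 0 1).
ring.
Qed.

Lemma psdmx3_form_ge0 (R : realType) (A : 'M[R]_3) : psdmx A ->
  forall p q r : R,
  0 <= A 0 0 * p ^+ 2 + A 1 1 * q ^+ 2 + A 2 2 * r ^+ 2
       + 2 * A 0 1 * p * q + 2 * A 2 0 * r * p + 2 * A 2 1 * r * q.
Proof.
move=> [symA A_ge0] p q r.
by have := A_ge0 (\col_i [:: p; q; r]`_i); rewrite mx3_formE// !mxE.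
Qed.

(** The two 2 x 2 blocks add up to a positive semidefinite matrix, because
    binary forms do. *)
Lemma sqr_le_mul_of_blocks (R : realFieldType) (x y Y w z u : R) :
  w <= x -> u <= Y -> (y - z) ^+ 2 <= (Y - u) * (x - w) ->
  (forall p q : R, 0 <= u * p ^+ 2 + 2 * z * p * q + w * q ^+ 2) ->
  y ^+ 2 <= Y * x.
Proof.
move=> wx uY hyp form_ge0; apply: discr_quad2_ge0 => p q.
have := @quad2_ge0 R (Y - u) (y - z) (x - w).
rewrite !subr_ge0 => /(_ uY wx hyp p q) blk.
by have := form_ge0 p q; lra.
Qed.

Lemma pair_hull_sqr_le (R : realType) (x1 x2 y1 y2 Y11 Y12 Y22 : R) :
  pair_hull x1 x2 y1 y2 Y11 Y12 Y22 ->
  y1 ^+ 2 <= Y11 * x1 /\ y2 ^+ 2 <= Y22 * x2.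
Proof.
move=> [W [/psdmx3_form_ge0 form_ge0 _ [h1 u1 w1] [h2 u2 w2] _]]; split.
  apply: (sqr_le_mul_of_blocks w1 u1 h1) => p q.
  by have := form_ge0 p 0 q; lra.
apply: (sqr_le_mul_of_blocks w2 u2 h2) => p q.
by have := form_ge0 0 p q; lra.
Qed.

(** The form of the rank-one matrix at (p, q, r) is the form of W at (q, r, p),
    plus the binary forms of the two hyperbolic constraints at (q, p) and
    (r, p), plus W33 p ^ 2. *)
Lemma pair_hull_psdmx (R : realType) (x1 x2 y1 y2 Y11 Y12 Y22 : R) :
  pair_hull x1 x2 y1 y2 Y11 Y12 Y22 ->
  psdmx (mx3 [:: [:: x1 + x2; y1; y2]; [:: y1; Y11; Y12]; [:: y2; Y12; Y22]]).
Proof.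
move=> [W [/psdmx3_form_ge0 form_ge0 <- [h1 u1 w1] [h2 u2 w2] _]].
set M := mx3 _.
have symM : M^T = M.
  by apply/matrixP => -[[|[|[|i]]] ?] // [[|[|[|j]]] ?] //; rewrite !mxE.
split=> // v; rewrite mx3_formE// !mxE /=.
move: (v 0 0) (v 1 0) (v 2 0) => p q r.
have := @quad2_ge0 R (Y11 - W 0 0) (y1 - W 2 0) (x1 - W 2 2).
rewrite !subr_ge0 => /(_ u1 w1 h1 q p) blk1.
have := @quad2_ge0 R (Y22 - W 1 1) (y2 - W 2 1) (x2 - W 2 2).
rewrite !subr_ge0 => /(_ u2 w2 h2 r p) blk2.
by have := form_ge0 q r p; have := form_ge0 0 0 p; lra.
Qed.

Lemma opt_pairs_sub_rank_one (R : realType) (n : nat) : (2 <= n)%N ->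
  opt_pairs R n `<=` opt_rank_one R n.
Proof.
move=> n_ge2 [[x y] Y] /= [symY psdY hull x01 y0]; split=> //; last first.
  by move=> i j ij; exact/pair_hull_psdmx/hull.
move=> i.
have [j ij] : exists j : 'I_n, j != i.
  have n_gt0 : (0 < n)%N := ltnW n_ge2.
  have [i0|i0] := eqVneq i (Ordinal n_gt0); last first.
    by exists (Ordinal n_gt0); rewrite eq_sym.
  by exists (Ordinal n_ge2); rewrite i0.
have [lt_ij|lt_ji|/val_inj eq_ij] := ltngtP i j.
- by have [] := pair_hull_sqr_le (hull _ _ lt_ij).
- by have [] := pair_hull_sqr_le (hull _ _ lt_ji).
- by rewrite eq_ij eqxx in ij.
Qed.

Theorem proposition7 (R : realType) (n : nat) (n_ge2 : (2 <= n)%N)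
    (a b : 'cV[R]_n) (Q : 'M[R]_n) (Q_psd : psdmx Q) :
  (opt_value a b Q (opt_rank_one R n) <= opt_value a b Q (opt_pairs R n))%E.
Proof.
by apply/le_ereal_inf/image_subset/opt_pairs_sub_rank_one.
Qed.
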